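(* Let $\langle X,\tau,\tau_S\rangle$ be the dual space of an S4-subordination algebra $\langle A,\prec\rangle$, and let $Y\subseteq X$ be a closed subset of $\langle X,\tau\rangle$. Then the following conditions are equivalent: (1) for each $x\in Y$, $\{y\in X:x\triangleleft_S y\}\subseteq Y$; (2) for all $U,V\in\mathrm{Clop}(X)$, if $(U,V)\in\theta(Y)$ then $\mathrm{int}_S(U)\cap Y=\mathrm{int}_S(V)\cap Y$; (3) the relation $\theta(Y)$ satisfies the condition SubCon; (4) $Y$ is saturated with respect to the topology $\tau_S$.
   Context: A subordination on a Boolean algebra $A$ is a binary relation $\prec$ on $A$ such that: (S1) $0\prec 0$ and $1\prec 1$; (S2) $a\prec b$ and $a\prec c$ imply $a\prec b\wedge c$; (S3) $a\prec c$ and $b\prec c$ imply $a\vee b\prec c$; (S4) $a\leq b\prec c\leq d$ implies $a\prec d$. The pair $\langle A,\prec\rangle$ is an S4-subordination algebra if moreover (S5) $a\prec b$ implies $a\leq b$, and (S6) $a\prec b$ implies that there is $c\in A$ with $a\prec c\prec b$. The dual space $\langle X,\tau,\tau_S\rangle$ of an S4-subordination algebra $\langle A,\prec\rangle$ is: $X=\mathrm{Ul}(A)$, the set of ultrafilters of $A$; $\tau$ is the Stone topology with base $\{\varphi(a):a\in A\}$, $\varphi(a)=\{x\in X:a\in x\}$; $\tau_S$ is the topology with base the sets $\beta({\downarrow}a)=\{x\in X:x\cap{\downarrow}a\neq\emptyset\}$, $a\in A$, where ${\downarrow}a=\{b\in A:b\prec a\}$. $\mathrm{Clop}(X)$ is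 the Boolean algebra of clopen subsets of $\langle X,\tau\rangle$; $\mathrm{int}_S$ denotes interior with respect to $\tau_S$. For $x,y\in X$, $x\triangleleft_S y$ iff for all $U\in\mathrm{Clop}(X)$, $x\in\mathrm{int}_S(U)$ implies $y\in U$. For a $\tau$-closed $Y\subseteq X$, $\theta(Y)=\{(a,b)\in A\times A:\varphi(a)\cap Y=\varphi(b)\cap Y\}$, a Boolean congruence of $A$; identifying $a\in A$ with $\varphi(a)\in\mathrm{Clop}(X)$, for $U,V\in\mathrm{Clop}(X)$ one writes $(U,V)\in\theta(Y)$ when $U\cap Y=V\cap Y$. A Boolean congruence $\theta$ of $A$ satisfies SubCon if whenever $c\prec a$ and $(a,b)\in\theta$, there exists $d\in A$ such that $d\prec b$ and $(c,d)\in\theta$. A subset $Y\subseteq X$ is saturated with respect to $\tau_S$ if $Y=\bigcap\{\mathrm{int}_S(U):Y\subseteq U\in\mathrm{Clop}(X)\}$. *)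

(* Defs.v *)
From HB Require Import structures.
From mathcomp Require Import all_boot all_order.
From mathcomp Require Import boolp classical_sets filter topology.

Set Implicit Arguments.
Unset Strict Implicit.
Unset Printing Implicit Defensive.

Import Order.TTheory.
Local Open Scope classical_set_scope.

(* A Boolean algebra is a ctbDistrLatticeType; the degenerate algebra, with
   \bot = \top, is allowed (its dual space is empty). *)

Record is_subordination d (A : ctbDistrLatticeType d) (prec : A -> A -> Prop)
    : Prop := IsSubordination {
  subord_bot : prec \bot%O \bot%O;
  subord_top : prec \top%O \top%O;
  subord_meet : forall a b c, prec a b -> prec a c -> prec a (b `&` c)%O;
  subord_join : forall a b c, prec a c -> prec b c -> prec (a `|` b)%O c;
  subord_le : forall a b c d, (a <= b)%O -> prec b c -> (c <= d)%O -> prec a d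
}.

Record s4_subordination d (A : ctbDistrLatticeType d) := S4Subordination {
  s4_rel :> A -> A -> Prop;
  s4_is_subordination : is_subordination s4_rel;
  s4_sub_le : forall a b, s4_rel a b -> (a <= b)%O;
  s4_dense : forall a b, s4_rel a b -> exists c, s4_rel a c /\ s4_rel c b
}.

Record proper_lattice_filter d (A : ctbDistrLatticeType d) (F : set A) : Prop :=
  ProperLatticeFilter {
  lfilter_top : F \top%O;
  lfilter_meet : forall a b, F a -> F b -> F (a `&` b)%O;
  lfilter_up : forall a b, (a <= b)%O -> F a -> F b;
  lfilter_proper : ~ F \bot%O
}.

Record Ul d (A : ctbDistrLatticeType d) := MkUl {
  ul_set :> set A;
  ul_filter : proper_lattice_filter ul_set;
  ul_max : forall G : set A,
    proper_lattice_filter G -> ul_set `<=` G -> G = ul_set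
}.

HB.instance Definition _ d (A : ctbDistrLatticeType d) := gen_eqMixin (Ul A).
HB.instance Definition _ d (A : ctbDistrLatticeType d) := gen_choiceMixin (Ul A).

Section DualSpace.
Context {d : Order.disp_t} {A : ctbDistrLatticeType d}.
Implicit Types (a b : A) (Y : set (Ul A)) (S : s4_subordination A).

Definition phi a : set (Ul A) := [set x : Ul A | ul_set x a].

Lemma phi_cover : \bigcup_(U in range phi) U = [set: Ul A].
Proof.
rewrite -subTset => x _; exists (phi \top%O); first by exists \top%O.
exact: lfilter_top (ul_filter x).
Qed.

Lemma phi_join (U V : set (Ul A)) x :
  range phi U -> range phi V -> U x -> V x ->
  exists W, [/\ range phi W, W x & W `<=` U `&` V].
Proof.
move=> [a _ <-] [b _ <-] xa xb; exists (phi (a `&` b)%O); split.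
- by exists (a `&` b)%O.
- exact: lfilter_meet (ul_filter x) _ _ xa xb.
- by move=> y yab; split; apply: lfilter_up (ul_filter y) _ _ _ yab;
    rewrite ?leIl ?leIr.
Qed.

(* The Stone topology is the canonical topology of Ul A. *)
HB.instance Definition _ :=
  @isBaseTopological.Build (Ul A) (set (Ul A)) (range phi) id phi_cover phi_join.

Definition down_S S a : set A := [set b | S b a].

Definition beta (F : set A) : set (Ul A) := [set x : Ul A | x `&` F !=set0].

Definition basis_S S : set (set (Ul A)) := range (fun a => beta (down_S S a)).

Lemma basis_S_cover S : \bigcup_(U in basis_S S) U = [set: Ul A].
Proof.
rewrite -subTset => x _; exists (beta (down_S S \top%O)); first by exists \top%O.
exists \top%O; split; first exact: lfilter_top (ul_filter x).
exact: subord_top (s4_is_subordination S).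
Qed.

Lemma basis_S_join S (U V : set (Ul A)) x :
  basis_S S U -> basis_S S V -> U x -> V x ->
  exists W, [/\ basis_S S W, W x & W `<=` U `&` V].
Proof.
have HS := s4_is_subordination S.
move=> [a _ <-] [b _ <-] [c [xc ca]] [e [xe eb]].
exists (beta (down_S S (a `&` b)%O)); split.
- by exists (a `&` b)%O.
- exists (c `&` e)%O; split; first exact: lfilter_meet (ul_filter x) _ _ xc xe.
  apply: (subord_meet HS).
  + exact: subord_le HS _ _ _ _ (leIl c e) ca (lexx a).
  + exact: subord_le HS _ _ _ _ (leIr e c) eb (lexx b).
- move=> y [f [yf fab]]; split; exists f; split=> //.
  + exact: subord_le HS _ _ _ _ (lexx f) fab (leIl a b).
  + exact: subord_le HS _ _ _ _ (lexx f) fab (leIr b a).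
Qed.

End DualSpace.

(* An alias of Ul A, with the topology tau_S instead of the Stone topology. *)
Definition UlS d (A : ctbDistrLatticeType d) (S : s4_subordination A) : Type :=
  Ul A.

HB.instance Definition _ d (A : ctbDistrLatticeType d)
  (S : s4_subordination A) := Choice.on (UlS S).

HB.instance Definition _ d (A : ctbDistrLatticeType d)
    (S : s4_subordination A) :=
  @isBaseTopological.Build (UlS S) (set (Ul A)) (basis_S S) id
    (basis_S_cover S) (@basis_S_join _ _ S).

Section Notions.
Context {d : Order.disp_t} {A : ctbDistrLatticeType d}.
Implicit Types (x y : Ul A) (U V Y : set (Ul A)) (S : s4_subordination A).

Definition int_S S U : set (Ul A) := @interior (UlS S) U.

Definition triangle_S S x y : Prop :=
  forall U, clopen U -> int_S S U x -> U y.

Definition theta Y (a b : A) : Prop := phi a `&` Y = phi b `&` Y.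

(* theta Y transported to clopen sets along phi. *)
Definition theta_clop Y U V : Prop := U `&` Y = V `&` Y.

Definition SubCon S (th : A -> A -> Prop) : Prop :=
  forall a b c : A, S c a -> th a b -> exists e : A, S e b /\ th c e.

Definition saturated_S S Y : Prop :=
  Y = \bigcap_(U in [set U | clopen U /\ Y `<=` U]) int_S S U.

End Notions.

(* Main.v *)
Require Import Defs.
From HB Require Import structures.
From mathcomp Require Import all_boot all_order.
From mathcomp Require Import boolp classical_sets filter topology.

Set Implicit Arguments.
Unset Strict Implicit.
Unset Printing Implicit Defensive.

Import Order.Theory.
Local Open Scope classical_set_scope.

(** Every condition of the theorem is a statement about ultrafilters, and each
    implication asks either for an ultrafilter with prescribed elements or for
    a single element of the algebra that witnesses an inclusion of sets of
    ultrafilters.  Both come from one compactness principle,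
    [filter_separation]: two lattice filters contained in no common
    ultrafilter contain disjoint elements.  Stone duality turns the topological
    notions into filters: a closed set consists of the ultrafilters extending
    its trace [trace_filter] ([closedP]), a clopen set is some [phi a]
    ([clopen_phi]), and the tau_S-interior of [phi a] is the basic open set
    [beta (down_S S a)] ([int_S_phi]); the last fact is where one uses
    that subordination is contained in the order and interpolates.  Accordingly, [x] is related to [y] by the specialization relation
    exactly when [y] extends the filter [up_S S x] of all [a] having some
    [c \in x] subordinate to [a] ([triangle_SP]).

    The four implications are then short.
    - (1) implies (2): if [x \in Y] lies in the interior of [phi a] but not in
      that of [phi b], then [a] belongs to [up_S S x] and [b] does not, so an
      ultrafilter [y] extends [up_S S x] and omits [b].  By (1) it lies in [Y],
      where [phi a] and [phi b] should agree.
    - (2) implies (3): if [c] is subordinate to [a], then by (2) the closed set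
      [phi c `&` Y] is covered by the sets [phi e] with [e] subordinate to [b].
      These form a directed family, so compactness gives one [e] that suffices,
      and the meet of [e] and [c] is the element required by SubCon.
    - (3) implies (4): if [Y] is contained in [phi a], apply SubCon to the top
      element, which is subordinate to itself and is congruent to [a].  The
      element [e] subordinate to [a] that it gives satisfies
      [Y `<=` phi e], and [phi e] is contained in the interior of [phi a].
    - (4) implies (1): a closed set is the intersection of the clopen sets [U]
      above it; if [Y] is saturated, [x \in Y] is in the interior of each such
      [U], so any [y] above [x] is in each [U]. *)

(** * Lattice filters and ultrafilters *)

(** Properness is left out, in contrast with [proper_lattice_filter]: compactness
    arguments conclude that a certain filter is improper, and the trace of the
    empty set is the whole algebra. *)
Record lattice_filter {d : Order.disp_t} {A : ctbDistrLatticeType d}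
    (F : set A) : Prop := LatticeFilter {
  filter_top : F \top%O;
  filter_meet : forall a b, F a -> F b -> F (a `&` b)%O;
  filter_up : forall a b, (a <= b)%O -> F a -> F b
}.

Section Filters.
Context {d : Order.disp_t} {A : ctbDistrLatticeType d}.
Implicit Types (a b c f g : A) (F G : set A) (x y : Ul A).

Lemma ul_lattice_filter x : lattice_filter (ul_set x).
Proof. by case: (ul_filter x) => *; split. Qed.

Lemma principal_filter a : lattice_filter [set b | (a <= b)%O].
Proof.
split=> [|b c /= ab ac|b c /= bc ab]; first exact: lex1.
  by rewrite lexI ab ac.
exact: le_trans ab bc.
Qed.

Definition filter_join F G : set A :=
  [set c | exists f g, [/\ F f, G g & (f `&` g <= c)%O]].

Lemma filter_join_lattice F G : lattice_filter F -> lattice_filter G ->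
  lattice_filter (filter_join F G).
Proof.
move=> [F1 FI _] [G1 GI _]; split.
- by exists \top%O, \top%O; split=> //; exact: lex1.
- move=> a b [f [g [Ff Gg fga]]] [f' [g' [Ff' Gg' fgb]]].
  exists (f `&` f')%O, (g `&` g')%O; split; [exact: FI|exact: GI|].
  by rewrite meetACA leI2.
- move=> a b ab [f [g [Ff Gg fga]]]; exists f, g; split=> //.
  exact: le_trans fga ab.
Qed.

Lemma filter_joinl F G : lattice_filter G -> F `<=` filter_join F G.
Proof. by move=> HG a Fa; exists a, \top%O; split; rewrite ?meetx1//; case: HG. Qed.

Lemma filter_joinr F G : lattice_filter F -> G `<=` filter_join F G.
Proof. by move=> HF a Ga; exists \top%O, a; split; rewrite ?meet1x//; case: HF. Qed.

Lemma ultrafilter_extension F : proper_lattice_filter F ->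
  exists x, F `<=` ul_set x.
Proof.
move=> HF.
(* The Zorn predicate concerns F `|` G rather than G, so that the empty chain,
   whose union is empty, satisfies it too. *)
pose P G := proper_lattice_filter (F `|` G).
have chainP (C : set (set A)) : C `<=` P -> total_on C subset ->
    P (\bigcup_(X in C) X).
  move=> CP Ctot; split; first by left; exact: lfilter_top HF.
  - have meetC X a b : C X -> (F `|` X) a -> (F `|` X) b ->
        (F `|` \bigcup_(X in C) X) (a `&` b)%O.
      move=> CX Xa Xb; have [?|?] := lfilter_meet (CP _ CX) Xa Xb.
        by left.
      by right; exists X.
    move=> a b [Fa|[X CX Xa]] [Fb|[X' CX' Xb]].
    + by left; exact: (lfilter_meet HF).
    + by apply: (meetC X'); [|left|right].
    + by apply: (meetC X); [|right|left].
    + have [sXX|sXX] := Ctot _ _ CX CX'.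
        by apply: (meetC X'); [|right; exact: sXX|right].
      by apply: (meetC X); [|right|right; exact: sXX].
  - move=> a b ab [Fa|[X CX Xa]]; first by left; exact: (lfilter_up HF) Fa.
    have [?|?] := lfilter_up (CP _ CX) ab (or_intror Xa); first by left.
    by right; exists X.
  - case=> [|[X CX X0]]; first exact: lfilter_proper HF.
    by apply: (lfilter_proper (CP _ CX)); right.
have [M [PM maxM]] := Zorn_bigcup chainP.
suff Mmax G : proper_lattice_filter G -> F `|` M `<=` G -> G = F `|` M.
  by exists (MkUl PM Mmax) => a Fa; left.
move=> HG sMG; apply/seteqP; split=> // a Ga; right; apply: contrapT => Ma.
have sFG : F `<=` G by move=> b Fb; apply: sMG; left.
apply: (maxM G); last by rewrite /P (setUidr sFG).
by split=> [b Mb|sGM]; [apply: sMG; right|exact/Ma/sGM].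
Qed.

(** The compactness of the Stone space in algebraic form: if the join of the
    two filters were proper, it would extend to an ultrafilter. *)
Lemma filter_separation F G : lattice_filter F -> lattice_filter G ->
  (forall x, F `<=` ul_set x -> G `<=` ul_set x -> False) ->
  exists f g, [/\ F f, G g & (f `&` g <= \bot)%O].
Proof.
move=> HF HG noU; apply: contrapT => no_fg.
have HFG := filter_join_lattice HF HG.
have [x FGx] : exists x, filter_join F G `<=` ul_set x.
  by apply: ultrafilter_extension; case: HFG => *; split.
apply: (noU x); apply: subset_trans FGx.
- exact: filter_joinl.
- exact: filter_joinr.
Qed.

Lemma le_of_disjoint_compl b f g :
  (~` b <= g)%O -> (f `&` g <= \bot)%O -> (f <= b)%O.
Proof.
move=> bg fg0; rewrite -[leRHS]complK -disj_leC -lex0; apply: le_trans fg0.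
by rewrite leI2.
Qed.

(** Maximality decides every [a]: if [a \notin x], no element of [x] is below
    [a], so [x] and the complement of [a] generate a proper filter, which must
    be [x]. *)
Lemma ul_compl x a : ul_set x (~` a)%O <-> ~ ul_set x a.
Proof.
split=> [xNa xa|xa].
  apply: (lfilter_proper (ul_filter x)); rewrite -(meetxC a).
  exact: (lfilter_meet (ul_filter x)).
have HNa := principal_filter (~` a)%O.
have Hx := ul_lattice_filter x.
have HJ := filter_join_lattice Hx HNa.
rewrite -(ul_max (u := x) (G := filter_join (ul_set x) [set b | (~` a <= b)%O])).
- by apply: filter_joinr => //=.
- case: HJ => *; split=> // -[f [g [xf /= ag fg0]]]; apply: xa.
  exact: (filter_up Hx) (le_of_disjoint_compl ag fg0) xf.
- exact: filter_joinl.
Qed.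

(** Separation of [F] from the principal filter of the complement of [a]: the
    two contain disjoint elements as soon as no ultrafilter extending [F]
    omits [a]. *)
Lemma filter_ultrafilters F a : lattice_filter F ->
  (forall x, F `<=` ul_set x -> ul_set x a) -> F a.
Proof.
move=> HF Fa; have [|f [g [Ff /= ag fg0]]] :=
    filter_separation HF (principal_filter (~` a)%O).
  move=> x Fx Nax; have /ul_compl : ul_set x (~` a)%O by exact/Nax/lexx.
  by apply; exact: Fa.
exact: (filter_up HF) (le_of_disjoint_compl ag fg0) Ff.
Qed.

(** * The Stone topology *)

Lemma phi_subset a b : phi a `<=` phi b <-> (a <= b)%O.
Proof.
split=> [ab|ab x]; last exact: (lfilter_up (ul_filter x)) ab.
apply: ((filter_ultrafilters (a := b) (principal_filter a))) => x ax.
exact/ab/ax/lexx.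
Qed.

Lemma open_phi a : open (phi a).
Proof.
by exists [set phi a]; [move=> _ ->; exists a|rewrite bigcup_set1].
Qed.

Lemma phi_compl a : phi (~` a)%O = ~` phi a.
Proof. by apply/seteqP; split=> x /ul_compl. Qed.

Lemma phi_clopen a : clopen (phi a).
Proof.
by split; [exact: open_phi|rewrite -openC -phi_compl; exact: open_phi].
Qed.

Definition trace_filter (Y : set (Ul A)) : set A := [set a | Y `<=` phi a].

Lemma trace_filter_lattice Y : lattice_filter (trace_filter Y).
Proof.
split.
- by move=> x _; exact: lfilter_top (ul_filter x).
- by move=> a b Ya Yb x Yx; apply: (lfilter_meet (ul_filter x));
    [exact: Ya|exact: Yb].
- by move=> a b /phi_subset ab Ya; exact: subset_trans ab.
Qed.

(** A point outside [Y] has a basic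
    neighbourhood [phi a] disjoint from [Y], so the complement of [a] is in the
    trace of [Y] but not in the point. *)
Lemma closedP (Y : set (Ul A)) x :
  closed Y -> Y x <-> trace_filter Y `<=` ul_set x.
Proof.
move=> cY; split=> [Yx a|Yx]; first exact.
apply: contrapT => nYx.
have : open (~` Y) by rewrite openC.
move=> [D sD DY].
have : (~` Y) x by []. rewrite -DY => -[U DU Ux].
have [a _ aU] := sD _ DU.
have xa : ul_set x a by move: Ux; rewrite -aU.
have /ul_compl : ul_set x (~` a)%O; last exact.
apply: Yx => y Yy; apply/ul_compl => ya.
have : (~` Y) y by rewrite -DY; exists U => //; rewrite -aU.
exact.
Qed.

(** A clopen set and its complement have traces without common ultrafilter;
    disjoint elements of these traces cut out the two sets exactly. *)
Lemma clopen_phi (U : set (Ul A)) : clopen U -> exists a, U = phi a.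
Proof.
move=> [oU cU].
have cNU : closed (~` U) by rewrite closedC.
have [|f [g [Uf NUg fg0]]] := filter_separation
    (trace_filter_lattice U) (trace_filter_lattice (~` U)).
  by move=> x /(closedP _ cU) Ux /(closedP _ cNU).
exists f; apply/seteqP; split=> // x xf; apply: contrapT => /NUg xg.
apply: (lfilter_proper (ul_filter x)); apply: (lfilter_up (ul_filter x) fg0).
exact: (lfilter_meet (ul_filter x)).
Qed.

End Filters.

(** * The topology of the subordination *)

Section Subordination.
Context {d : Order.disp_t} {A : ctbDistrLatticeType d} (S : s4_subordination A).
Implicit Types (a b c : A) (x y : Ul A).

Let HS := s4_is_subordination S.

Definition up_S (F : set A) : set A := [set a | exists2 c, F c & S c a].

Lemma up_S_lattice F : lattice_filter F -> lattice_filter (up_S F).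
Proof.
move=> HF; split.
- exists \top%O; [exact: filter_top|exact: subord_top HS].
- move=> a b [c Fc ca] [e Fe eb]; exists (c `&` e)%O; first exact: filter_meet.
  apply: (subord_meet HS).
  + exact: (subord_le HS (leIl c e) ca (lexx a)).
  + exact: (subord_le HS (leIr e c) eb (lexx b)).
- move=> a b ab [c Fc ca]; exists c => //.
  exact: (subord_le HS (lexx c) ca ab).
Qed.

(** The complements of the elements subordinate to [b] form a filter base,
    because those elements form an ideal; an ultrafilter extends this filter
    exactly when it is outside [beta (down_S S b)]. *)
Lemma subord_compl_filter b :
  lattice_filter [set g | exists2 e, S e b & (~` e <= g)%O].
Proof.
split.
- exists \bot%O; last exact: lex1.
  exact: (subord_le HS (lexx _) (subord_bot HS) (le0x b)).
- move=> g h [e eb eg] [e' e'b e'h]; exists (e `|` e')%O.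
    exact: (subord_join HS).
  by rewrite complU leI2.
- by move=> g h gh [e eb eg]; exists e => //; exact: le_trans gh.
Qed.

(** A basic open set inside [phi a] may come from an element [b] that is not
    below [a].  Interpolating [c] and [b] by some [e] repairs this: [phi e] is
    inside the basic open set, hence [e <= a]. *)
Lemma int_S_phi a : int_S S (phi a) = beta (down_S S a).
Proof.
apply/seteqP; split=> x; rewrite /int_S /interior nbhsE.
- move=> [V [[D sD DV] Vx] Va].
  move: Vx; rewrite -DV => -[W DW Wx].
  have [b _ bW] := sD _ DW.
  move: (Wx); rewrite -bW => -[c [xc cb]].
  exists c; split=> //.
  have [e [ce eb]] := s4_dense cb.
  suff ea : (e <= a)%O by exact: (subord_le HS (lexx c) ce ea).
  apply/phi_subset => y ye; apply: Va; rewrite -DV.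
  by exists W => //; rewrite -bW; exists e.
- move=> xa; exists (beta (down_S S a)).
    split=> //; exists [set beta (down_S S a)]; last by rewrite bigcup_set1.
    by move=> _ ->; exists a.
  move=> y [c [yc ca]]; exact: (lfilter_up (ul_filter y) (s4_sub_le ca)).
Qed.

Lemma int_S_phiP a x : int_S S (phi a) x <-> up_S (ul_set x) a.
Proof.
rewrite int_S_phi; split=> [[c [xc ca]]|[c xc ca]]; first by exists c.
by exists c.
Qed.

Lemma triangle_SP x y : triangle_S S x y <-> up_S (ul_set x) `<=` ul_set y.
Proof.
split=> [xy a /int_S_phiP xa|xy U /clopen_phi[a ->] /int_S_phiP].
  exact: xy (phi_clopen a) xa.
exact: xy.
Qed.

(** Only one inclusion is stated, since [theta Y] is symmetric. *)
Lemma int_S_subset_of_triangle (Y : set (Ul A)) :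
  (forall x, Y x -> [set y | triangle_S S x y] `<=` Y) ->
  forall a b, theta Y a b -> int_S S (phi a) `&` Y `<=` int_S S (phi b).
Proof.
move=> HY a b ab x [/int_S_phiP xa Yx]; apply/int_S_phiP.
apply: filter_ultrafilters; first exact/up_S_lattice/ul_lattice_filter.
move=> y xy; have Yy : Y y by apply: HY Yx _ _; exact/triangle_SP.
have : (phi a `&` Y) y by split=> //; exact: xy.
by rewrite ab => -[].
Qed.

(** By compactness: the sets [phi e], for [e] subordinate to [b], form a directed
    cover, so one of them contains the closed set. *)
Lemma closed_subset_beta (Z : set (Ul A)) b : closed Z ->
  Z `<=` beta (down_S S b) -> exists2 e, S e b & Z `<=` phi e.
Proof.
move=> cZ Zb.
have [|f [g [Zf [e eb eg] fg0]]] := filter_separation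
    (trace_filter_lattice Z) (subord_compl_filter b).
  move=> x /(closedP _ cZ) /Zb[e [xe eb]] Nx.
  have /ul_compl : ul_set x (~` e)%O by apply: Nx; exists e.
  exact.
exists e => //; apply: subset_trans Zf _; apply/phi_subset.
exact: le_of_disjoint_compl eg fg0.
Qed.

Lemma SubCon_of_int_S (Y : set (Ul A)) : closed Y ->
  (forall a b, theta Y a b -> int_S S (phi a) `&` Y = int_S S (phi b) `&` Y) ->
  SubCon S (theta Y).
Proof.
move=> cY HY a b c ca ab.
have [||e eb Ye] := @closed_subset_beta (phi c `&` Y) b.
- by apply: closedI => //; case: (phi_clopen c).
- move=> x [xc Yx]; rewrite -int_S_phi.
  suff : (int_S S (phi a) `&` Y) x by rewrite (HY _ _ ab) => -[].
  by split=> //; apply/int_S_phiP; exists c.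
(* Meeting with c turns the inclusion given by compactness into the equality
   required by theta Y. *)
exists (c `&` e)%O; split.
  exact: (subord_le HS (leIr e c) eb (lexx b)).
apply/seteqP; split=> x [xc Yx]; split=> //.
- by apply: (lfilter_meet (ul_filter x) xc); exact: Ye.
- exact: (lfilter_up (ul_filter x) (leIl c e)).
Qed.

Lemma saturated_of_SubCon (Y : set (Ul A)) :
  closed Y -> SubCon S (theta Y) -> saturated_S S Y.
Proof.
move=> cY HY; apply/seteqP; split=> x.
- move=> Yx _ [/clopen_phi[a ->] Ya]; apply/int_S_phiP.
  (* the top element is subordinate to itself and congruent to a *)
  have [||e [ea te]] := HY \top%O a \top%O; first exact: (subord_top HS).
    apply/seteqP; split=> y [_ Yy]; split=> //; first exact: Ya.
    exact: lfilter_top (ul_filter y).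
  exists e => //.
  have : (phi \top%O `&` Y) x by split=> //; exact: lfilter_top (ul_filter x).
  by rewrite te => -[].
- move=> Yx; apply/(closedP _ cY) => a Ya.
  exact: (@interior_subset (UlS S)) (Yx _ (conj (phi_clopen a) Ya)).
Qed.

Lemma triangle_of_saturated (Y : set (Ul A)) : closed Y -> saturated_S S Y ->
  forall x, Y x -> [set y | triangle_S S x y] `<=` Y.
Proof.
move=> cY satY x Yx y xy; apply/(closedP _ cY) => a Ya.
apply: xy (phi_clopen a) _.
by move: Yx; rewrite satY; apply; split=> //; exact: phi_clopen.
Qed.

End Subordination.

Theorem theorem21 (d : Order.disp_t) (A : ctbDistrLatticeType d)
    (S : s4_subordination A) (Y : set (Ul A)) (hY : closed Y) :
  [<-> forall x : Ul A, Y x -> [set y | triangle_S S x y] `<=` Y;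
       forall U V : set (Ul A), clopen U -> clopen V ->
         theta_clop Y U V -> int_S S U `&` Y = int_S S V `&` Y;
       SubCon S (theta Y);
       saturated_S S Y ].
Proof.
tfae.
- move=> HY U V /clopen_phi[a ->] /clopen_phi[b ->] ab.
  apply/seteqP; split=> x xY; split; try by case: xY.
  + exact: int_S_subset_of_triangle HY _ _ ab _ xY.
  + exact: int_S_subset_of_triangle HY _ _ (esym ab) _ xY.
- move=> HY; apply: SubCon_of_int_S => // a b.
  exact: HY (phi_clopen a) (phi_clopen b).
- exact: saturated_of_SubCon.
- exact: triangle_of_saturated.
Qed.
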